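(* Let $m\ge2$, $d\ge 2$, and let $\mathbf g:\mathbb{Z}\to\mathcal T$ be a two-sided geodesic in the $d$-regular rooted tree $\mathcal T$ with $\mathbf g(0)=\mathbf r$. Let $S_n=\{0,1,\dots,n-1\}^m$. For $s\in\mathbb{R}^m$ with $|s|_{\ell_1}<1$, let $h^s_{\partial S_n}:\partial S_n\to\mathbf g$ be the boundary graph homomorphism given by $$h^s_{\partial S_n}(x)=\begin{cases}\mathbf g(\lfloor s\cdot x\rfloor),&\text{if } x \text{ and } \mathbf g(\lfloor s\cdot x\rfloor)\text{ have the same parity},\\ \mathbf g(\lfloor s\cdot x\rfloor+1),&\text{otherwise}.\end{cases}$$ Then the limit $$\mathrm{ent}(s):=\lim_{n\to\infty}\mathrm{Ent}(S_n,h^s_{\partial S_n})$$ exists. (It defines the local surface tension $\mathrm{ent}(s)$; for $|s|_{\ell_1}=1$ one defines $\mathrm{ent}(s):=0$.)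
   Context: $\mathcal T$ is the $d$-regular tree with root $\mathbf r$ and graph distance $d_{\mathcal T}$. A two-sided geodesic is an injective graph homomorphism $\mathbb{Z}\to\mathcal T$. For finite $\Lambda\subset\mathbb{Z}^m$, $h:\Lambda\to\mathcal T$ is a graph homomorphism if $d_{\mathcal T}(h(x),h(y))=1$ whenever $x,y\in\Lambda$, $|x-y|_{\ell_1}=1$. $\partial\Lambda=\{x\in\Lambda:\exists y\notin\Lambda,|x-y|_{\ell_1}=1\}$. For a graph homomorphism $h_{\partial\Lambda}:\partial\Lambda\to\mathcal T$, $M(\Lambda,h_{\partial\Lambda})$ is the set of graph homomorphisms $h:\Lambda\to\mathcal T$ with $h=h_{\partial\Lambda}$ on $\partial\Lambda$, and $\mathrm{Ent}(\Lambda,h_{\partial\Lambda})=-\frac1{|\Lambda|}\ln|M(\Lambda,h_{\partial\Lambda})|$. Fix proper 2-colourings of the bipartite graphs $\mathbb{Z}^m$ and $\mathcal T$; the colour of a vertex is called its parity. $s\cdot x$ is the Euclidean inner product. *)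

(* Defs.v *)
From HB Require Import structures.
From mathcomp Require Import all_boot all_order all_algebra finmap.
From mathcomp Require Import all_classical all_reals all_analysis.
From mathcomp Require Import zify ring lra.
Import Order.TTheory GRing.Theory Num.Theory numFieldNormedType.Exports.

Set Implicit Arguments.
Unset Strict Implicit.
Unset Printing Implicit Defensive.

Local Open Scope classical_set_scope.
Local Open Scope fset_scope.
Local Open Scope ring_scope.

Section Trees.
Variables (T : choiceType) (adj : rel T).

Definition walk (x y : T) (n : nat) : Prop :=
  exists p : seq T, [/\ path adj x p, last x p = y & size p = n].

(* The cycle condition starts at length 3 because [cycle adj [:: x; y]] holds
   for every edge of a symmetric relation. *)
Definition is_tree : Prop :=
  [/\ symmetric adj,
      irreflexive adj,
      forall x y : T, exists n : nat, walk x y n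
    & forall c : seq T, (2 < size c)%N -> ~ ucycle adj c].

Definition is_regular (d : nat) : Prop :=
  forall x : T, exists s : seq T, [/\ uniq s, size s = d & s =i adj x].

(* The value is the junk 0 when x and y are not connected. *)
Definition gdist (x y : T) : nat :=
  xget 0%N [set n | walk x y n /\ forall k : nat, walk x y k -> (n <= k)%N].

Definition graph_hom (D : Type) (eD : rel D) (f : D -> T) : Prop :=
  forall x y : D, eD x y -> gdist (f x) (f y) = 1%N.

Definition int_adj : rel int := fun i j => `|i - j| == 1.

Definition two_sided_geodesic (g : int -> T) : Prop :=
  injective g /\ graph_hom int_adj g.

End Trees.

Definition proper_2colouring (V : Type) (e : rel V) (c : V -> bool) : Prop :=
  forall x y : V, e x y -> c x != c y.

Definition l1norm (K : numDomainType) (m : nat) (x : 'rV[K]_m) : K :=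
  \sum_(i < m) `|x 0 i|.

Definition lattice_adj (m : nat) : rel 'rV[int]_m :=
  fun x y => l1norm (x - y) == 1.

Definition boundary (m : nat) (L : {fset 'rV[int]_m}) : {fset 'rV[int]_m} :=
  [fset x in L | `[< exists y, y \notin L /\ lattice_adj x y >]].

Definition sub_adj (m : nat) (L : {fset 'rV[int]_m}) : rel L :=
  fun x y => lattice_adj (val x) (val y).

Section Entropy.
Variables (R : realType) (T : choiceType) (adj : rel T) (m : nat).

Definition extensions (L : {fset 'rV[int]_m}) (b : boundary L -> T) :
    set {ffun L -> T} :=
  [set h | graph_hom adj (@sub_adj m L) h /\
           forall (x : L) (y : boundary L), val x = val y -> h x = b y].

(* For m >= 1 and a locally finite tree, [extensions L b] is finite, so that
   [fset_set] does not take its junk value. *)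
Definition Ent (L : {fset 'rV[int]_m}) (b : boundary L -> T) : R :=
  - (#|` L|%:R)^-1 * ln (#|` fset_set (extensions b)|%:R).

End Entropy.

Definition box (m n : nat) : {fset 'rV[int]_m} :=
  [fset (\row_(i < m) (u i)%:Z)%R | u : {ffun 'I_m -> 'I_n} in predT].

Lemma in_box (m n : nat) (x : 'rV[int]_m) :
  (x \in box m n) = [forall i, 0 <= x 0 i < n%:Z].
Proof.
apply/imfsetP/forallP => [[u _ ->] i|xn]; first by rewrite mxE /= ltz_nat ltn_ord.
have lt i : (`|x 0%R i| < n)%N by have := xn i; lia.
exists [ffun i => Ordinal (lt i)] => //=.
by apply/rowP => i; rewrite mxE ffunE /=; have := xn i; lia.
Qed.

Definition dot (R : realType) (m : nat) (s : 'rV[R]_m) (x : 'rV[int]_m) : R :=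
  \sum_(i < m) s 0 i * (x 0 i)%:~R.

Section Slope.
Variables (R : realType) (T : choiceType) (m : nat).
Variables (cZ : 'rV[int]_m -> bool) (cT : T -> bool).
Variables (g : int -> T) (s : 'rV[R]_m).

Definition slope_fun (x : 'rV[int]_m) : T :=
  let k := Num.floor (dot s x) in
  if cZ x == cT (g k) then g k else g (k + 1).

Definition slope_boundary (n : nat) (x : boundary (box m n)) : T :=
  slope_fun (val x).

End Slope.

(* The local surface tension on the set |s|_1 <= 1; the value 0 outside this
   set is junk. *)
Definition ent (R : realType) (T : choiceType) (adj : rel T) (m : nat)
    (cZ : 'rV[int]_m -> bool) (cT : T -> bool) (g : int -> T)
    (s : 'rV[R]_m) : R :=
  if l1norm s < 1 then
    limn (fun n : nat => Ent R adj (slope_boundary cZ cT g s (n:=n)))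
  else 0.

Section SlopeHom.
Variables (R : realType) (T : choiceType) (adj : rel T) (m : nat).
Variables (cZ : 'rV[int]_m -> bool) (cT : T -> bool).
Variables (g : int -> T) (s : 'rV[R]_m).
Hypothesis adj_irr : irreflexive adj.
Hypothesis cZP : proper_2colouring (@lattice_adj m) cZ.
Hypothesis cTP : proper_2colouring adj cT.
Hypothesis gP : two_sided_geodesic adj g.
Hypothesis s1 : l1norm s < 1.

Lemma gdist1P (x y : T) : gdist adj x y = 1%N <-> adj x y.
Proof.
split=> [|axy]; rewrite /gdist.
  case: xgetP => [n _ [[p [pp pl sz]] _]|_] n1 //.
  by case: p pp pl sz => [|z [|? ?]] /=; rewrite n1 // andbT => axz <-.
apply: xget_unique => [|k [wk k1]].
  split=> [|k [p [_ pl <-]]]; first by exists [:: y]; rewrite /= andbT.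
  by case: p pl => //= xy; move: axy; rewrite xy adj_irr.
have k_le1 : (k <= 1)%N by apply: k1; exists [:: y]; rewrite /= andbT.
case: k wk k_le1 {k1} => [wk _|[//|k _ //]].
case: wk => p [_ pl /size0nil p0].
by move: axy; rewrite -pl p0 /= adj_irr.
Qed.

Let cg (k : int) : cT (g (k + 1)) = ~~ cT (g k).
Proof.
have /gdist1P/cTP : gdist adj (g k) (g (k + 1)) = 1%N.
  by apply: gP.2; rewrite /int_adj opprD addrA subrr sub0r normrN1.
by case: (cT _) (cT _) => [] [].
Qed.

Let dot_lt (x y : 'rV[int]_m) : lattice_adj x y -> `|dot s x - dot s y| < 1.
Proof.
move=> /eqP xy; apply: le_lt_trans s1.
rewrite /dot -sumrB /l1norm.
apply: le_trans (ler_norm_sum _ _ _) _; apply: ler_sum => i _.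
rewrite -mulrBr normrM -intrB -intr_norm -[leRHS]mulr1 ler_wpM2l // lerz1.
rewrite -xy /l1norm (bigD1 i) //= !mxE lerDl sumr_ge0 //.
Qed.

(* Restricting to the boundary of a box, [slope_boundary] is a graph
   homomorphism; restricting to the box itself, it has an extension, so that
   [ent] never involves the junk value ln 0. *)
Lemma slope_fun_hom : graph_hom adj (@lattice_adj m) (slope_fun cZ cT g s).
Proof.
move=> x y xy; have dlt := dot_lt xy; have cxy := cZP xy.
rewrite /slope_fun.
have [fx1 fx2] := andP (floor_itv (dot s x)).
have [fy1 fy2] := andP (floor_itv (dot s y)).
move: (Num.floor (dot s x)) (Num.floor (dot s y)) fx1 fx2 fy1 fy2.
move=> a b a1 a2 b1 b2.
have ab : a - b < 2.
  by rewrite -(ltr_int R) intrB; move: dlt a1 a2 b1 b2; rewrite ltr_norml !intrD => /andP[]; lra.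
have ba : b - a < 2.
  by rewrite -(ltr_int R) intrB; move: dlt a1 a2 b1 b2; rewrite ltr_norml !intrD => /andP[]; lra.
have {ab ba} : [\/ b = a, b = a + 1 | a = b + 1].
  have : (b == a) || ((b == a + 1) || (a == b + 1)) by lia.
  by case/or3P => /eqP; [constructor 1|constructor 2|constructor 3].
case=> ->; rewrite ?cg; move: cxy; case: (cZ x) (cZ y) (cT _) => [] [] [] //= _;
  apply: gP.2; rewrite /int_adj; lia.
Qed.

End SlopeHom.

(* Main.v *)
Require Import Defs.
From mathcomp Require Import all_boot all_order all_algebra finmap.
From mathcomp Require Import all_classical all_reals all_analysis.
From mathcomp Require Import zify ring lra.
Import Order.TTheory GRing.Theory Num.Theory numFieldNormedType.Exports.

(** The numbers [M_n] of extensions are supermultiplicative up to a bounded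
    corridor: [M_n ^ (N / (n + 2 D)) ^ m <= M_N]. Indeed, tile the box of side [N]
    by cells of side [n + 2 D] and put a translated copy of an extension in the
    core of each cell. The translate of the boundary condition differs from the
    slope function by a translation along the geodesic, which comes from a locally
    injective homomorphism of the tree, and by a bounded correction of the height,
    which is tapered off across the corridor; as [|s|_1 < 1], this keeps the height
    strictly 1-Lipschitz once [D] is large, and rounding it to the right parity
    gives a homomorphism between the cores. A homomorphism of the box is
    determined by its steps along one coordinate direction, so
    [ln M_n <= n ^ m ln (d + 1)], and a Fekete argument concludes. *)

Local Open Scope classical_set_scope.
Local Open Scope ring_scope.

(** * Depth and parents in a rooted tree *)

Section TreeShift.
Variables (T : choiceType) (adj : rel T) (r : T).
Hypothesis htree : is_tree adj.

Let adjC : symmetric adj. Proof. by case: htree. Qed.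
Let adj_irr : irreflexive adj. Proof. by case: htree. Qed.
Let acyclic (c : seq T) : (2 < size c)%N -> ~ ucycle adj c.
Proof. by case: htree => _ _ _; apply. Qed.

Local Notation depth := (gdist adj r).

Lemma gdist_walk (x y : T) :
  walk adj x y (gdist adj x y) /\
  forall k, walk adj x y k -> (gdist adj x y <= k)%N.
Proof.
rewrite /gdist; case: xgetP => [n _ //|none].
have exw : exists n, `[< walk adj x y n >].
  by case: htree => _ _ /(_ x y) [n xy] _; exists n; apply/asboolP.
case: (ex_minnP exw) => n /asboolP xyn nmin.
by case: (none n); split=> // k /asboolP; exact: nmin.
Qed.

Lemma depth_root : depth r = 0%N.
Proof.
by apply/eqP; rewrite -leqn0; apply: (gdist_walk r r).2; exists [::].
Qed.

Lemma depth_eq0 (v : T) : depth v = 0%N -> v = r.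
Proof.
move=> v0; have [[p [_ lp sp]] _] := gdist_walk r v.
by rewrite -lp; move: sp; rewrite v0 => /size0nil ->.
Qed.

Lemma depth_adj (v w : T) : adj v w -> (depth w <= (depth v).+1)%N.
Proof.
move=> vw; apply: (gdist_walk r w).2.
have [[p [pp lp sp]] _] := gdist_walk r v.
by exists (rcons p w); rewrite rcons_path last_rcons size_rcons lp pp sp vw.
Qed.

Lemma depth_pred (v : T) n :
  depth v = n.+1 -> exists2 w, adj v w & depth w = n.
Proof.
move=> vn; have [[p [pp lp sp]] _] := gdist_walk r v.
move: sp; rewrite vn; case/lastP: p pp lp => [//|p z].
rewrite rcons_path last_rcons size_rcons => /andP[pp pz] zv [sp].
rewrite zv in pz; exists (last r p); first by rewrite adjC.
have le1 : (depth (last r p) <= n)%N.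
  by apply: (gdist_walk r _).2; exists p.
have := depth_adj (last r p) v; rewrite vn => /(_ pz).
by lia.
Qed.

(* Two distinct vertices of the same depth are joined by a path not leaving the
   ball of that depth; closing it by an edge or a deeper vertex gives a cycle. *)
Lemma level_path n (v w : T) :
  depth v = n -> depth w = n -> v != w ->
  exists p, [/\ path adj v p, last v p = w, uniq (v :: p),
    (1 < size p)%N & forall x, x \in v :: p -> (depth x <= n)%N].
Proof.
elim: n v w => [|n IH] v w vn wn vw.
  by move: vw; rewrite (depth_eq0 _ vn) (depth_eq0 _ wn) eqxx.
have [a va an] := depth_pred _ _ vn; have [b wb bn] := depth_pred _ _ wn.
have [p [pp lp up dp]] : exists p, [/\ path adj a p, last a p = b,
    uniq (a :: p) & forall x, x \in a :: p -> (depth x <= n)%N].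
  have [ab|ab] := eqVneq a b; last by have [p []] := IH a b an bn ab; exists p.
  by exists [::]; rewrite ab; split=> // x; rewrite inE => /eqP ->; rewrite bn.
have out x : depth x = n.+1 -> x \notin a :: p.
  by move=> xn; apply/negP => /dp; rewrite xn ltnn.
exists (a :: rcons p w); split.
- by rewrite /= rcons_path va pp lp adjC wb.
- by rewrite /= last_rcons.
- rewrite cons_uniq -rcons_cons rcons_uniq mem_rcons in_cons negb_or vw.
  by rewrite !out.
- by rewrite /= size_rcons.
- move=> x; rewrite inE -rcons_cons mem_rcons inE.
  by case/or3P => [/eqP->|/eqP->|/dp /leqW //]; rewrite ?vn ?wn.
Qed.

(** If the depths agreed, [level_path] would join the ends by a path of at least two steps, which
    the edge closes to a cycle. *)
Lemma adj_depth_neq (v w : T) : adj v w -> depth v <> depth w.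
Proof.
move=> vw dvw; have vnw : v != w by apply/eqP => e; rewrite e adj_irr in vw.
have [p [pp lp up sp _]] := level_path _ _ _ dvw erefl vnw.
apply: (acyclic (v :: p)); first by [].
by rewrite /ucycle up andbT /= rcons_path pp lp adjC.
Qed.

(** Two distinct such neighbours are joined by a path of vertices less deep than [v], and [v] closes
    it to a cycle. *)
Lemma depth_pred_uniq (v a b : T) : adj v a -> adj v b ->
  (depth a).+1 = depth v -> (depth b).+1 = depth v -> a = b.
Proof.
move=> va vb av bv; apply/eqP; apply: contraT => ab.
have ba : depth a = depth b by lia.
have [p [pp lp up sp dp]] := level_path _ _ _ ba erefl ab.
case: (acyclic (v :: a :: p)); first exact: ltnW.
rewrite /ucycle cons_uniq up andbT /= va rcons_path pp lp adjC vb /=.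
by apply/negP => /dp; lia.
Qed.

(** At the root no neighbour qualifies, and the value is the default [r]. *)
Definition parent (v : T) : T :=
  xget r [set w | adj v w /\ (depth w).+1 = depth v].

Lemma parentP (v : T) :
  (0 < depth v)%N -> adj v (parent v) /\ (depth (parent v)).+1 = depth v.
Proof.
rewrite /parent; case: xgetP => [w _ //|none].
case dv: (depth v) => [//|n] _.
by have [w vw wn] := depth_pred _ _ dv; case: (none w); split=> //; rewrite wn.
Qed.

Lemma adj_parent (v w : T) : adj v w ->
  (w = parent v /\ depth v = (depth w).+1) \/
  (v = parent w /\ depth w = (depth v).+1).
Proof.
move=> vw; have wv : adj w v by rewrite adjC.
have /eqP dvw := adj_depth_neq _ _ vw.
have := depth_adj _ _ vw; have := depth_adj _ _ wv.
move: dvw; rewrite neq_ltn => /orP[lt|lt] le1 le2; [right|left].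
  have dw : depth w = (depth v).+1 by lia.
  have [|pw dpw] := parentP w; first by lia.
  by split=> //; apply: (depth_pred_uniq w) => //; lia.
have dv : depth v = (depth w).+1 by lia.
have [|pv dpv] := parentP v; first by lia.
by split=> //; apply: (depth_pred_uniq v) => //; lia.
Qed.

(** A step to the parent would return to the preceding vertex of the ray, so injectivity forces
    every step one level deeper. *)
Lemma depth_ray (ray : nat -> T) : injective ray -> ray 0%N = r ->
  (forall k, adj (ray k) (ray k.+1)) ->
  forall k, depth (ray k) = k /\ parent (ray k.+1) = ray k.
Proof.
move=> inj ray0 ray_adj.
have step k : depth (ray k) = k -> (forall j, k = j.+1 -> parent (ray k) = ray j) ->
    depth (ray k.+1) = k.+1 /\ parent (ray k.+1) = ray k.
  move=> dk pk; have [[e d]|[e d]] := adj_parent _ _ (ray_adj k).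
    case: k dk pk e d => [|k] dk pk e d; first by move: d; rewrite dk.
    by move: e; rewrite (pk k) // => /inj /eqP; lia.
  by rewrite -e d dk.
suff H k : [/\ depth (ray k) = k, depth (ray k.+1) = k.+1
    & parent (ray k.+1) = ray k] by move=> k; case: (H k).
elim: k => [|k [_ dk pk]].
  have d0 : depth (ray 0%N) = 0%N by rewrite ray0 depth_root.
  by have [] := step _ d0 (fun j e => False_ind _ (O_S j e)).
by have [|? ?] := step _ dk; first by move=> j [<-].
Qed.

End TreeShift.

(** * Locally injective homomorphisms translating the geodesic *)

(** Both neighbourhoods are listed with [d] entries, marked vertices first, and entries of equal
    index are matched; the equality of the two tests puts the marked vertices at equal indices. *)
Lemma local_injection (T : choiceType) (adj : rel T) (d : nat)
    (hreg : is_regular adj d) (u u' a b a' b' : T) :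
  adj u a -> adj u b -> adj u' a' -> adj u' b' -> (a == b) = (a' == b') ->
  exists f : T -> T, [/\ forall x, adj u x -> adj u' (f x),
    forall x y, adj u x -> adj u y -> f x = f y -> x = y, f a = a' & f b = b'].
Proof.
move=> ua ub ua' ub' ab.
have list v x y : adj v x -> adj v y -> exists t, [/\ uniq t, size t = d, t =i adj v,
    index x t = 0%N & index y t = (x != y)].
  move=> vx vy; have [t [ut st tv]] := hreg v.
  have xt : x \in t by rewrite tv.
  have yt : y \in t by rewrite tv.
  have [e|xy] := eqVneq x y.
    have := perm_to_rem xt => p; exists (x :: rem x t); rewrite -(perm_uniq p) -(perm_size p).
    by rewrite -e /= eqxx; split=> // z; rewrite -(perm_mem p) tv.
  have yt' : y \in rem x t by rewrite mem_rem_uniq // inE eq_sym xy.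
  have p : perm_eq t (x :: y :: rem y (rem x t)).
    by apply: perm_trans (perm_to_rem xt) _; rewrite perm_cons perm_to_rem.
  exists (x :: y :: rem y (rem x t)); rewrite -(perm_uniq p) -(perm_size p).
  by rewrite /= !eqxx (negPf xy); split=> // z; rewrite -(perm_mem p) tv.
have [t [ut st tu ia ib]] := list u a b ua ub.
have [t' [ut' st' tu' ia' ib']] := list u' a' b' ua' ub'.
have ind x : adj u x -> (index x t < size t')%N.
  move=> ux; rewrite st' -st index_mem. by rewrite (tu x).
exists (fun x => nth a' t' (index x t)); split.
- by move=> x ux; rewrite -[adj _ _]/(_ \in adj u') -tu' mem_nth // ind.
- move=> x y ux uy /eqP; rewrite nth_uniq ?ind // => /eqP.
  by apply: index_inj; rewrite ?(tu x) ?(tu y).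
- by rewrite ia -ia' nth_index // tu'.
- by rewrite ib ab -ib' nth_index // tu'.
Qed.

(** The map is built outwards from the root [g 0]. Local injectivity is enough for pasting, because
    homomorphisms of a box are recovered one lattice step at a time. *)
Lemma geodesic_shift (T : choiceType) (adj : rel T) (d : nat) (g : int -> T) (c : int) :
  is_tree adj -> is_regular adj d -> two_sided_geodesic adj g ->
  exists f : T -> T, [/\ forall k, f (g k) = g (k + c),
    forall x y, adj x y -> adj (f x) (f y)
    & forall x y z, adj x y -> adj x z -> f y = f z -> y = z].
Proof.
move=> htree hreg [g_inj g_hom]; have [adjC adj_irr _ _] := htree.
have g_adj k l : `|k - l| = 1 -> adj (g k) (g l).
  by move=> kl; apply/(gdist1P adj_irr)/g_hom; rewrite /int_adj kl.
set r := g 0; pose depth := gdist adj r; pose par := parent T adj r.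
(* Here [u'] is the image of [u], while [a] and [a'] stand for the parent of [u] and its image. On
   the geodesic both neighbours along [g] are prescribed instead; away from the root, one of them is
   the parent. *)
pose spec (p : T * T * T * T) (i : T -> T) :=
  let: (u, u', a, a') := p in
  [/\ forall x, adj u x -> adj u' (i x),
      forall x y, adj u x -> adj u y -> i x = i y -> x = y,
      forall k, u = g k -> u' = g (k + c) ->
        i (g (k - 1)) = g (k - 1 + c) /\ i (g (k + 1)) = g (k + 1 + c)
    & (forall k, u <> g k) -> adj u a -> adj u' a' -> i a = a'].
(* The degree is positive because [g 1] is a neighbour of [r]. Such a neighbour serves as marked
   vertex when nothing is prescribed. *)
have nbr x : exists y, adj x y.
  have [t [_ st tx]] := hreg x; have [t0 [_ st0 t0x]] := hreg r.
  have : g 1 \in t0 by rewrite t0x; apply: g_adj.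
  case: t st tx => [/=|y t] st tx.
    by move=> gt; have := size0nil (etrans st0 (esym st)) => e; rewrite e in gt.
  by exists y; have := mem_head y t; rewrite tx.
have /boolp.choice[J JP] : forall p, exists i, spec p i.
  move=> -[[[u u'] a] a'] /=.
  have [b ub] := nbr u; have [b' ub'] := nbr u'.
  case: (pselect (exists k, u = g k /\ u' = g (k + c))) => [[k [uk uk']]|nk].
    have [|||||f [f1 f2 f3 f4]] := local_injection T adj d hreg u u'
      (g (k - 1)) (g (k + 1)) (g (k - 1 + c)) (g (k + 1 + c)).
    - by rewrite uk; apply: g_adj; lia.
    - by rewrite uk; apply: g_adj; lia.
    - by rewrite uk'; apply: g_adj; lia.
    - by rewrite uk'; apply: g_adj; lia.
    - by rewrite !(inj_eq g_inj); lia.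
    exists f; split=> // [l|/(_ k)//].
    by rewrite uk => /g_inj <-.
  case: (pselect (adj u a /\ adj u' a')) => [[ua ua']|na].
    have [|||||f [f1 f2 f3 f4]] := local_injection T adj d hreg u u' a a a' a';
      rewrite ?eqxx //.
    by exists f; split=> // k uk uk'; case: nk; exists k.
  have [|||||f [f1 f2 f3 f4]] := local_injection T adj d hreg u u' b b b' b';
    rewrite ?eqxx //.
  exists f; split=> // [k uk uk'|_ ua ua']; first by case: nk; exists k.
  by case: na.
(* [G] gives the images of the parent of [v] and of [v]: each vertex sends its
   children by an injection of its neighbours that is compatible with the image
   already chosen for its parent, and with the translation of [g]. *)
pose G := fix G (n : nat) (v : T) {struct n} : T * T := if n is n'.+1 then
  let: (q, u') := G n' (par v) in (u', J (par v, u', par (par v), q) v)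
  else (r, g c).
pose f v := (G (depth v) v).2.
pose q v := (G (depth v) v).1.
have par_adj v : (0 < depth v)%N -> adj v (par v) /\ (depth (par v)).+1 = depth v.
  exact: parentP.
have GS v : (0 < depth v)%N -> q v = f (par v) /\
   f v = J (par v, f (par v), par (par v), q (par v)) v.
  move=> dv; have [_] := par_adj v dv.
  rewrite /q /f; case: (depth v) dv => // n _ [<-] /=.
  by case: (G _ _).
have f_par v : (0 < depth v)%N -> adj (f (par v)) (f v).
  move=> dv; rewrite (GS v dv).2.
  by have [+ _ _ _] := JP (par v, f (par v), par (par v), q (par v)); apply;
     rewrite adjC; have [] := par_adj v dv.
have par_or v w : adj v w -> (w = par v /\ (0 < depth v)%N) \/ (v = par w /\ (0 < depth w)%N).
  by move=> /(adj_parent T adj r htree)[[e d']|[e d']]; [left|right];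
    split=> //; rewrite /depth d'.
have f_hom v w : adj v w -> adj (f v) (f w).
  by move=> /par_or[[-> dv]|[-> dw]]; [rewrite adjC|]; exact: f_par.
(* Both halves of the geodesic are rays from the root, so parents along [g] point towards [g 0]. *)
have rayP (n : nat) : depth (g n%:Z) = n /\ par (g n.+1%:Z) = g n%:Z.
  apply: (depth_ray T adj r htree (fun n : nat => g n%:Z)) => // [i j /g_inj[]//|k].
  by apply: g_adj; lia.
have rayN (n : nat) : depth (g (- n%:Z)) = n /\ par (g (- n.+1%:Z)) = g (- n%:Z).
  apply: (depth_ray T adj r htree (fun n : nat => g (- n%:Z))) => // [i j /g_inj|k].
    by lia.
  by apply: g_adj; lia.
have f_g0 : f (g 0) = g (0 + c) by rewrite /f (rayP 0%N).1 add0r.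
have f_gP (n : nat) : f (g n%:Z) = g (n%:Z + c).
  elim: n => [//|n IH]; have [|_ ->] := GS (g n.+1%:Z); first by rewrite (rayP _).1.
  rewrite (rayP n).2 IH; have [_ _ /(_ n%:Z erefl erefl)[_ +] _] :=
    JP (g n%:Z, g (n%:Z + c), par (g n%:Z), q (g n%:Z)).
  by rewrite (_ : n.+1%:Z = n%:Z + 1); last lia.
have f_gN (n : nat) : f (g (- n%:Z)) = g (- n%:Z + c).
  elim: n => [//|n IH]; have [|_ ->] := GS (g (- n.+1%:Z)); first by rewrite (rayN _).1.
  rewrite (rayN n).2 IH; have [_ _ /(_ (- n%:Z) erefl erefl)[+ _] _] :=
    JP (g (- n%:Z), g (- n%:Z + c), par (g (- n%:Z)), q (g (- n%:Z))).
  by rewrite (_ : - n.+1%:Z = - n%:Z - 1); last lia.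
have f_g k : f (g k) = g (k + c).
  by case: (intP k) => [//|n|n]; [exact: f_gP|exact: f_gN].
exists f; split=> //.
(* On all neighbours of [v], [f] is the injection chosen at [v]: on children by construction, on the
   parent by the last two clauses of [spec]. *)
have f_J v y : adj v y -> f y = J (v, f v, par v, q v) y.
  move=> vy; have [[-> dv]|[e dy]] := par_or _ _ vy; last first.
    by rewrite (GS y dy).2 -e.
  have [_ _ Jg Jpar] := JP (v, f v, par v, q v).
  case: (pselect (exists k, v = g k)) => [[k vk]|nk]; last first.
    have nk' k : v <> g k by move=> e; apply: nk; exists k.
    rewrite Jpar //; first by rewrite (GS v dv).1.
      by have [] := par_adj v dv.
    by rewrite (GS v dv).1 adjC; exact: f_par.
  have [|J1 J2] := Jg k vk; first by rewrite vk f_g.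
  move: dv; rewrite vk in J1 J2 *; case: (intP k) J1 J2 => [|n|n] J1 J2.
  - by rewrite (rayP 0%N).1.
  - move=> _; have e : par (g n.+1%:Z) = g (n.+1%:Z - 1).
      by rewrite (rayP n).2; congr g; lia.
    by rewrite -e in J1; rewrite J1 e f_g.
  - move=> _; have e : par (g (- n.+1%:Z)) = g (- n.+1%:Z + 1).
      by rewrite (rayN n).2; congr g; lia.
    by rewrite -e in J2; rewrite J2 e f_g.
move=> v y z vy vz; rewrite (f_J _ _ vy) (f_J _ _ vz).
by have [_ + _ _] := JP (v, f v, par v, q v); apply.
Qed.

(** * Colourings and rounding to a prescribed parity *)

Lemma alternating_int (e : int -> bool) :
  (forall k, e (k + 1) = ~~ e k) -> forall k, e k = e 0 (+) odd `|k|%N.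
Proof.
move=> eS; have eP (n : nat) : e n%:Z = e 0 (+) odd n.
  elim: n => [|n IH]; first by rewrite addbF.
  by rewrite (_ : n.+1%:Z = n%:Z + 1) ?eS ?IH /= ?addbN //; lia.
have eN (n : nat) : e (- n%:Z) = e 0 (+) odd n.
  elim: n => [|n IH]; first by rewrite oppr0 addbF.
  by have := eS (- n.+1%:Z); rewrite (_ : - n.+1%:Z + 1 = - n%:Z) ?IH /= ?addbN;
    [case: (e (- _)) (_ (+) _) => -[]|lia].
move=> k; case: (intP k) => [|n|n]; [by rewrite addbF|exact: eP|].
by rewrite abszN; exact: eN.
Qed.

(** Each unit step flips the colour, so the colour is the parity of the coordinate sum up to a
    constant; [cZ 0] compensates for that constant. *)
Lemma lattice_colour_add (m : nat) (cZ : 'rV[int]_m -> bool) :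
  proper_2colouring (@lattice_adj m) cZ ->
  forall w y, cZ (w + y) = cZ w (+) cZ y (+) cZ 0.
Proof.
move=> hcZ.
have step a i (k : int) : cZ (a + k *: delta_mx 0 i) = cZ a (+) odd `|k|%N.
  rewrite (alternating_int (fun k => cZ (a + k *: delta_mx 0 i))) ?scale0r ?addr0 //.
  move=> {}k; suff /hcZ : lattice_adj (a + (k + 1) *: delta_mx 0 i) (a + k *: delta_mx 0 i).
    by case: (cZ _) (cZ _) => -[].
  rewrite /lattice_adj /l1norm (bigD1 i) //= big1 => [|j ji]; rewrite !mxE /=
    ?eqxx ?(negPf ji).
    by lia.
  by lia.
have sum a x (r : seq 'I_m) : cZ (a + \sum_(i <- r) x 0 i *: delta_mx 0 i) =
    cZ a (+) \big[addb/false]_(i <- r) odd `|x 0%R i|%N.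
  elim: r a => [|i r IH] a; first by rewrite !big_nil addr0 addbF.
  by rewrite !big_cons addrA IH step addbA.
have colour a x : cZ (a + x) = cZ a (+) \big[addb/false]_(i < m) odd `|x 0%R i|%N.
  by rewrite {1}(row_sum_delta x) sum.
move=> w y; rewrite colour -{2}[y]add0r colour.
by case: (cZ w) (cZ 0) (\big[_/_]_(_ < _) _) => [] [] [].
Qed.

Section ParityRound.
Variables (R : realType) (T : choiceType) (cT : T -> bool) (g : int -> T).

(** The rounding inside [slope_fun], isolated so that it also applies to perturbed heights. *)
Definition parity_round (t : R) (b : bool) : int :=
  if b == cT (g (Num.floor t)) then Num.floor t else Num.floor t + 1.

Lemma slope_funE (m : nat) (cZ : 'rV[int]_m -> bool) (s : 'rV[R]_m) x :
  slope_fun cZ cT g s x = g (parity_round (dot s x) (cZ x)).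
Proof. by rewrite /slope_fun /parity_round; case: ifP. Qed.

Lemma parity_round_bound t b :
  t - 1 < (parity_round t b)%:~R /\ (parity_round t b)%:~R <= t + 1.
Proof.
have /andP[] := floor_itv t; rewrite /parity_round.
by case: ifP => _; rewrite ?intrD; lra.
Qed.

Hypothesis alt : forall k, cT (g (k + 1)) = ~~ cT (g k).

Lemma parity_round_colour t b : cT (g (parity_round t b)) = b.
Proof.
rewrite /parity_round; case: eqP => [//|]; rewrite alt.
by case: b (cT _) => -[].
Qed.

(** The floor commutes with integer translations, and the condition on [b'] flips the colour exactly
    when [c] is odd. *)
Lemma parity_round_shift t c b b' : b' = b (+) cT (g c) (+) cT (g 0) ->
  parity_round (t + c%:~R) b' = parity_round t b + c.
Proof.
move=> ->; rewrite /parity_round floorDrz ?intr_int // intrKfloor.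
have add k : cT (g (k + c)) = cT (g k) (+) cT (g c) (+) cT (g 0).
  have altc l : cT (g (l + 1 + c)) = ~~ cT (g (l + c)) by rewrite addrAC alt.
  rewrite (alternating_int (fun l => cT (g (l + c))) altc) add0r.
  rewrite (alternating_int (fun l => cT (g l)) alt k).
  by case: (cT _) (cT _) (odd _) => -[] [].
rewrite add; case: (cT _) (cT _) (cT _) b => -[] [] [] //=; by rewrite addrAC.
Qed.

(** The rounding bounds put the difference strictly between -3 and 3, and distinct colours make it
    odd. *)
Lemma parity_round_adj t t' b b' : `|t - t'| < 1 -> b != b' ->
  `|parity_round t b - parity_round t' b'| = 1.
Proof.
move=> tt bb; have [a1 a2] := parity_round_bound t b.
have [b1 b2] := parity_round_bound t' b'.
have := parity_round_colour t b; have := parity_round_colour t' b'.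
rewrite (alternating_int (fun l => cT (g l)) alt (parity_round t b)).
rewrite (alternating_int (fun l => cT (g l)) alt (parity_round t' b')).
move: (parity_round t b) (parity_round t' b') a1 a2 b1 b2 => k l a1 a2 b1 b2 cl ck.
move: tt; rewrite ltr_norml => /andP[tt1 tt2].
have kl1 : k - l < 3 by rewrite -(ltr_int R) intrB; lra.
have kl2 : l - k < 3 by rewrite -(ltr_int R) intrB; lra.
have odds : odd `|k|%N != odd `|l|%N.
  by move: bb; rewrite -ck -cl; case: (cT _) (odd _) (odd _) => -[] [].
lia.
Qed.

End ParityRound.

(** * Lattice neighbours and the tiling by cells *)

Lemma lattice_adj_coord (m : nat) (x y : 'rV[int]_m) i :
  lattice_adj x y -> `|x 0 i - y 0 i| <= 1.
Proof.
by move=> /eqP <-; rewrite /l1norm (bigD1 i) //= !mxE lerDl sumr_ge0.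
Qed.

Lemma lattice_adjC (m : nat) : symmetric (@lattice_adj m).
Proof.
move=> x y; rewrite /lattice_adj /l1norm; congr (_ == _).
by apply: eq_bigr => i _; rewrite !mxE distrC.
Qed.

Lemma dot_lipschitz (R : realType) (m : nat) (s : 'rV[R]_m) (x y : 'rV[int]_m) :
  lattice_adj x y -> `|dot s x - dot s y| <= l1norm s.
Proof.
move=> xy; rewrite /dot -sumrB /l1norm.
apply: le_trans (ler_norm_sum _ _ _) _; apply: ler_sum => i _.
rewrite -mulrBr normrM -intrB -intr_norm -[leRHS]mulr1 ler_wpM2l // lerz1.
exact: lattice_adj_coord.
Qed.

Section Cells.
Variables (m n D : nat).

Definition period : int := (n + D.*2)%:Z.

Definition cell (x : 'rV[int]_m) : 'rV[int]_m := \row_i (x 0%R i %/ period)%Z.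

(** The lower corner of the core of the cell [u], at depth [D] inside the cell. *)
Definition origin (u : 'rV[int]_m) : 'rV[int]_m :=
  \row_i (u 0 i * period + D%:Z).

Definition offset (x : 'rV[int]_m) : 'rV[int]_m := x - origin (cell x).

(* Twice the distance from [r] to the interval [D, D + n - 1]. *)
Definition core_dist (r : int) : int :=
  `|r - D%:Z| + `|r - (D%:Z + n%:Z - 1)| - (n%:Z - 1).

(** A cutoff, 1 on the core, that decreases at rate [1 / D] in the l1 distance to the core and
    vanishes on the faces of the cell. *)
Definition plateau (R : realType) (x : 'rV[int]_m) : R :=
  Num.max 0 (1 - (\sum_(i < m) core_dist (x 0%R i %% period)%Z)%:~R / (D.*2)%:R).

Hypotheses (n_gt0 : (0 < n)%N) (D_gt0 : (0 < D)%N).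

Let P_gt0 : 0 < period. Proof. by rewrite /period; lia. Qed.

Let modP (a : int) : 0 <= (a %% period)%Z < period.
Proof. by rewrite modz_ge0 ?ltz_pmod //; lia. Qed.

Lemma offsetE x i : offset x 0 i = (x 0%R i %% period)%Z - D%:Z.
Proof. by rewrite !mxE {1}(divz_eq (x 0 i) period); ring. Qed.

Lemma origin_offset x : origin (cell x) + offset x = x.
Proof. by rewrite /offset addrC subrK. Qed.

Lemma cell_origin (u y : 'rV[int]_m) : y \in box m n -> cell (origin u + y) = u.
Proof.
rewrite in_box => /forallP yn; apply/rowP => i; rewrite !mxE -addrA.
move: (yn i) => {yn}; rewrite /period divzMDl; last by lia.
by move: (y 0 i) => a ya; rewrite divz_small ?addr0 //; lia.
Qed.

Lemma offset_origin (u y : 'rV[int]_m) : y \in box m n -> offset (origin u + y) = y.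
Proof. by move=> yn; rewrite /offset cell_origin // addrC addKr. Qed.

Lemma origin_in_box N (u y : 'rV[int]_m) : u \in box m (N %/ (n + D.*2)) -> y \in box m n ->
  origin u + y \in box m N.
Proof.
rewrite !in_box => /forallP uK /forallP yn; apply/forallP => i.
rewrite !mxE /period; have := uK i; have := yn i.
have := leq_trunc_div N (n + D.*2).
have : (n + D < n + D.*2)%N by lia.
move: (n + D.*2)%N (u 0 i) (y 0 i) => P a b nP KN bn aK.
move: (N %/ P)%N KN aK => K KN aK.
have : 0 <= (K%:Z - 1 - a) * P%:Z by apply: mulr_ge0; lia.
have : 0 <= a * P%:Z by apply: mulr_ge0; lia.
by nia.
Qed.

Lemma core_dist_ge0 r : 0 <= core_dist r.
Proof. by rewrite /core_dist; lia. Qed.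

Lemma plateau_core (R : realType) (x : 'rV[int]_m) : offset x \in box m n -> plateau R x = 1.
Proof.
rewrite in_box => /forallP xn; rewrite /plateau big1 => [|i _].
  by rewrite mul0r subr0 max_r.
by have := xn i; rewrite offsetE /core_dist; lia.
Qed.

Lemma plateau_edge (R : realType) (x : 'rV[int]_m) i :
  (x 0%R i %% period)%Z = 0 \/ (x 0%R i %% period)%Z = period - 1 -> plateau R x = 0.
Proof.
move=> xi; rewrite /plateau max_l // subr_le0 ler_pdivlMr ?ltr0n ?double_gt0 //.
rewrite mul1r -[leLHS]/((D.*2)%:Z%:~R) ler_int (bigD1 i) //=.
have : 0 <= \sum_(j < m | j != i) core_dist (x 0%R j %% period)%Z.
  by apply: sumr_ge0 => j _; exact: core_dist_ge0.
by move: (\sum_(j < m | _) _); case: xi => ->; rewrite /core_dist /period; lia.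
Qed.

Lemma plateau_lipschitz (R : realType) (x y : 'rV[int]_m) :
  lattice_adj x y -> cell x = cell y ->
  `|plateau R x - plateau R y| <= D%:R^-1.
Proof.
move=> /eqP xy cxy; rewrite /plateau.
set X := \sum_(i < m) _; set Y := \sum_(i < m) core_dist (y 0%R i %% period)%Z.
have XY : `|X - Y| <= 2.
  have -> : (2 : int) = 2 * l1norm (x - y) by rewrite xy.
  rewrite /l1norm mulr_sumr /X /Y -sumrB.
  apply: le_trans (ler_norm_sum _ _ _) _; apply: ler_sum => i _.
  rewrite !mxE; have /rowP/(_ i) := cxy; rewrite !mxE.
  move: (divz_eq (x 0 i) period) (divz_eq (y 0 i) period).
  move: (x 0%R i %/ period)%Z (y 0%R i %/ period)%Z => a b.
  move: (x 0%R i %% period)%Z (y 0%R i %% period)%Z => t t' ex ey ab.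
  rewrite {}ex {}ey {}ab; move: (b * period) => c.
 by rewrite /core_dist; lia.
have D2 : (D.*2)%:R^-1 * 2 = D%:R^-1 :> R.
  by rewrite -muln2 natrM invfM -mulrA mulVf ?mulr1 // pnatr_eq0.
have : `|X%:~R / (D.*2)%:R - Y%:~R / (D.*2)%:R| <= D%:R^-1 :> R.
  rewrite -mulrBl -intrB normrM normfV normr_nat -D2 mulrC ler_wpM2l ?invr_ge0 //.
  by rewrite -intr_norm -[leRHS]/((2:int)%:~R) ler_int.
set a := _ / _; set b := _ / _ => ab.
rewrite /Num.max; case: ltP => h1; case: ltP => h2; move: ab; rewrite ?ler_norml => /andP[];
  try by move=> *; apply/andP; split; lra.
Qed.

(** Such neighbours lie on facing faces of their cells. Hence corrections of different cells do not
    interact. *)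
Lemma cell_change (x y : 'rV[int]_m) : lattice_adj x y -> cell x != cell y ->
  forall R, plateau R x = 0 /\ plateau R y = 0.
Proof.
move=> xy cxy R.
have [i ci] : exists i, (x 0%R i %/ period)%Z != (y 0%R i %/ period)%Z.
  apply/existsP; apply: contra_neqT cxy; rewrite negb_exists => /forallP c.
  by apply/rowP => i; rewrite !mxE; apply/eqP; move: (c i); rewrite negbK.
have := lattice_adj_coord m x y i xy.
move: ci (modP (x 0 i)) (modP (y 0 i)) (divz_eq (x 0 i) period) (divz_eq (y 0 i) period).
have bx := plateau_edge R x i; have by_ := plateau_edge R y i; move: bx by_.
move: (x 0%R i %/ _)%Z (y 0%R i %/ _)%Z (x 0%R i %% _)%Z (y 0%R i %% _)%Z P_gt0.
move: period (x 0 i) (y 0 i) => P xi yi a b r t P0 bx by_ ab r1 t1 ex ey xy1.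
have /orP[lt|lt] : (a < b) || (b < a) by lia.
  have : 0 <= (b - a - 1) * P by apply: mulr_ge0; lia.
  move=> h; split; [apply: bx; right|apply: by_; left]; lia.
have : 0 <= (a - b - 1) * P by apply: mulr_ge0; lia.
move=> h; split; [apply: bx; left|apply: by_; right]; lia.
Qed.

End Cells.

(** * Boundaries of boxes and the number of extensions *)

Lemma boundaryP (m : nat) (L : {fset 'rV[int]_m}) x :
  reflect (x \in L /\ exists y, y \notin L /\ lattice_adj x y) (x \in boundary L).
Proof.
apply: (iffP idP); rewrite /boundary !inE /=.
  by case/andP => xL /asboolP.
by case=> xL xy; apply/andP; split=> //; apply/asboolP.
Qed.

Lemma boundary_box (m N : nat) (x : 'rV[int]_m) : x \in boundary (box m N) ->
  exists i, x 0 i = 0 \/ x 0 i = N%:Z - 1.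
Proof.
case/boundaryP; rewrite in_box => /forallP xN [y []].
rewrite in_box negb_forall => /existsP[i yi] xy; exists i.
have := lattice_adj_coord m x y i xy; move: (xN i) yi.
by move: (x 0 i) (y 0 i) => a b; lia.
Qed.

Lemma card_le_finType (A : Type) (F : finType) (S : set A) (f : A -> F) :
  {in S &, injective f} -> (S #<= `I_#|F|)%card.
Proof.
move=> f_inj; apply/pcard_leP/injfunPex; exists (fun x => nat_of_ord (enum_rank (f x))).
  by move=> x _ /=; exact: ltn_ord.
by move=> x y xS yS /val_inj /enum_rank_inj; exact: f_inj.
Qed.

Section SlopeHom.
Variables (R : realType) (T : choiceType) (adj : rel T) (m d : nat).
Variables (cZ : 'rV[int]_m -> bool) (cT : T -> bool).
Variables (g : int -> T) (s : 'rV[R]_m) (i0 : 'I_m).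
Hypothesis adj_irr : irreflexive adj.
Hypothesis hreg : is_regular adj d.

(** Extensions as functions on the whole lattice, which are easy to translate; only the values on
    the box matter. *)
Definition slope_hom (n : nat) (h : 'rV[int]_m -> T) :=
  (forall x y, x \in box m n -> y \in box m n -> lattice_adj x y ->
     adj (h x) (h y)) /\
  forall x, x \in boundary (box m n) -> h x = slope_fun cZ cT g s x.

Definition back (x : 'rV[int]_m) : 'rV[int]_m := x - delta_mx 0 i0.

Lemma back_adj x : lattice_adj (back x) x.
Proof.
rewrite /lattice_adj /l1norm /back (bigD1 i0) //= big1 => [|j ji].
  by rewrite !mxE !eqxx /= addr0 addrAC subrr sub0r normrN1.
by rewrite !mxE eqxx (negPf ji) subr0 subrr normr0.
Qed.

Lemma back_in n x : x \in box m n -> x \notin boundary (box m n) -> back x \in box m n.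
Proof.
move=> xn; apply: contraNT => bn; apply/boundaryP; split=> //.
by exists (back x); split=> //; rewrite lattice_adjC back_adj.
Qed.

(* Values propagate from the boundary along lines of direction [i0]. *)
Lemma slope_hom_eq n h h' : slope_hom n h -> slope_hom n h' ->
  (forall x, x \in box m n -> back x \in box m n ->
     h (back x) = h' (back x) -> h x = h' x) ->
  {in box m n, h =1 h'}.
Proof.
move=> hn hn' step x xn.
have [k xk] : exists k : nat, x 0 i0 = k%:Z.
  move: (xn); rewrite in_box => /forallP/(_ i0).
  by case: (x 0 i0) => k; [exists k|].
elim: k x xk xn => [|k IH] x xk xn;
  (have [xb|xb] := boolP (x \in boundary (box m n)); first by rewrite hn.2 ?hn'.2).
  have := back_in n x xn xb; rewrite in_box => /forallP/(_ i0).
  by rewrite !mxE !eqxx xk.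
apply: step => //; [exact: back_in|apply: IH; [|exact: back_in]].
by rewrite !mxE !eqxx xk; lia.
Qed.

Definition extend n (h : {ffun box m n -> T}) (x : 'rV[int]_m) : T :=
  if insub x is Some z then h z else g 0.

Lemma extendE n (h : {ffun box m n -> T}) z : extend n h (val z) = h z.
Proof. by rewrite /extend valK. Qed.

Lemma extensionsP n (h : {ffun box m n -> T}) :
  extensions adj (@slope_boundary R T m cZ cT g s n) h <-> slope_hom n (extend n h).
Proof.
split=> -[hom bnd]; split.
- move=> x y xn yn xy.
  rewrite -[x]/(val [` xn]%fset) -[y]/(val [` yn]%fset) !extendE.
  by apply/(gdist1P adj_irr)/hom.
- move=> x xb; have [xn _] := boundaryP _ _ _ xb.
  rewrite -[x in extend _ _ x]/(val [` xn]%fset) extendE.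
  exact: (bnd _ [` xb]%fset).
- move=> x y xy; apply/(gdist1P adj_irr); rewrite -!extendE.
  by apply: hom xy; exact: valP.
- move=> x y xy; rewrite -extendE xy; apply: bnd; exact: valP.
Qed.

Lemma extensions_restrict n (h : 'rV[int]_m -> T) : slope_hom n h ->
  extensions adj (@slope_boundary R T m cZ cT g s n)
    [ffun z : box m n => h (val z)].
Proof.
move=> [hom bnd]; split=> [x y xy|x y xy].
  by rewrite !ffunE; apply/(gdist1P adj_irr)/hom => //; exact: valP.
by rewrite ffunE xy; apply: bnd; exact: valP.
Qed.

Lemma card_box n : #|` box m n| = (n ^ m)%N.
Proof.
rewrite /box card_imfset /=.
  by rewrite -cardE card_ffun !card_ord.
move=> u v /rowP uv; apply/ffunP => i; apply: val_inj.
by have := uv i; rewrite !mxE => -[].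
Qed.

(* A homomorphism is encoded by its steps in direction [i0]: each value is one
   of the [d] neighbours of the preceding one. *)
Lemma extensions_card_le n :
  (extensions adj (@slope_boundary R T m cZ cT g s n) #<= `I_(d.+1 ^ (n ^ m)))%card.
Proof.
have /boolp.choice[nbr nbrP] := hreg.
(* The extra code [d] is the value of [index] on a non-neighbour, which can occur where [back]
   leaves the box. *)
pose code (h : {ffun box m n -> T}) : {ffun box m n -> 'I_d.+1} :=
  [ffun z => inord (index (h z) (nbr (extend n h (back (val z)))))].
rewrite -[d.+1]card_ord -card_box cardfE -card_ffun; apply: (card_le_finType _ _ _ code).
move=> h h' /set_mem/extensionsP hn /set_mem/extensionsP hn' /ffunP hh'.
apply/ffunP => z; rewrite -!extendE; apply: (slope_hom_eq n _ _ hn hn'); last exact: valP.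
move=> x xn bn e; have := hh' [` xn]%fset; rewrite !ffunE -!extendE /= e.
set t := nbr _; have [_ st tP] := nbrP (extend n h' (back x)).
have a1 : extend n h x \in t by rewrite tP /= -e; apply: hn.1 => //; exact: back_adj.
have a2 : extend n h' x \in t by rewrite tP /=; apply: hn'.1 => //; exact: back_adj.
move=> /(congr1 val); rewrite /= !inordK ?ltnS -?st ?index_size //.
by move=> eqi; rewrite -(nth_index (g 0) a1) eqi nth_index.
Qed.

Definition num_ext n : nat :=
  #|` fset_set (extensions adj (@slope_boundary R T m cZ cT g s n))|.

Lemma num_ext_le n : (num_ext n <= d.+1 ^ (n ^ m))%N.
Proof. exact/geq_card_fset_set/extensions_card_le. Qed.

Lemma extensions_finite n :
  finite_set (extensions adj (@slope_boundary R T m cZ cT g s n)).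
Proof. exact: card_le_finite (extensions_card_le n) (finite_II _). Qed.

Lemma card_le_num_ext n (F : finType) (f : F -> 'rV[int]_m -> T) :
  (forall a, slope_hom n (f a)) ->
  (forall a b, {in box m n, f a =1 f b} -> a = b) ->
  (#|F| <= num_ext n)%N.
Proof.
move=> fn f_inj; pose res a := [ffun z : box m n => f a (val z)].
have res_inj : injective res.
  move=> a b /ffunP ab; apply: f_inj => x xn.
  by have := ab [` xn]%fset; rewrite !ffunE.
rewrite cardE -(size_map res); apply: uniq_leq_size.
  by rewrite map_inj_uniq ?enum_uniq.
move=> _ /mapP[a _ ->]; rewrite in_fset_set; last exact: extensions_finite.
exact/mem_set/extensions_restrict.
Qed.

End SlopeHom.

(** * Pasting translated extensions into the cells of a large box *)

Section Pasting.
Variables (R : realType) (T : choiceType) (adj : rel T) (m d D : nat).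
Variables (cZ : 'rV[int]_m -> bool) (cT : T -> bool).
Variables (g : int -> T) (s : 'rV[R]_m) (shift : int -> T -> T).
Hypothesis adj_irr : irreflexive adj.
Hypothesis hcZ : proper_2colouring (@lattice_adj m) cZ.
Hypothesis hcT : proper_2colouring adj cT.
Hypothesis hg : two_sided_geodesic adj g.
Hypothesis shift_g : forall c k, shift c (g k) = g (k + c).
Hypothesis shift_adj : forall c x y, adj x y -> adj (shift c x) (shift c y).
Hypothesis shift_inj : forall c x y z,
  adj x y -> adj x z -> shift c y = shift c z -> y = z.
Hypotheses (D_gt0 : (0 < D)%N) (sD : l1norm s + D%:R^-1 < 1).

Let g_adj k l : `|k - l| = 1 -> adj (g k) (g l).
Proof. by move=> kl; apply/(gdist1P adj_irr)/hg.2; rewrite /int_adj kl. Qed.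

Let alt k : cT (g (k + 1)) = ~~ cT (g k).
Proof.
have /hcT : adj (g (k + 1)) (g k) by apply: g_adj; lia.
by case: (cT _) (cT _) => -[].
Qed.

Let dotD x y : dot s (x + y) = dot s x + dot s y.
Proof.
by rewrite /dot -big_split; apply: eq_bigr => i _; rewrite !mxE intrD mulrDr.
Qed.

Section Cell.
Variable n : nat.
Hypothesis n_gt0 : (0 < n)%N.

Local Notation cell := (cell m n D).
Local Notation origin := (origin m n D).
Local Notation offset := (offset m n D).
Local Notation plateau := (plateau m n D R).

(* The parity is the one for which translation by [origin u] in the lattice and
   by [cell_shift u] along [g] have the same effect on colours. *)
Definition cell_shift (u : 'rV[int]_m) : int :=
  parity_round R T cT g (dot s (origin u)) (cZ (origin u) (+) cZ 0 (+) cT (g 0)).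

(** The height error made by translating along [g] by an integer instead of by the exact slope
    height of the corner. *)
Definition correction (u : 'rV[int]_m) : R :=
  (cell_shift u)%:~R - dot s (origin u).

Lemma correction_le1 u : `|correction u| <= 1.
Proof.
have [] := parity_round_bound R T cT g (dot s (origin u))
  (cZ (origin u) (+) cZ 0 (+) cT (g 0)).
by rewrite /correction /cell_shift ler_norml; lra.
Qed.

Definition height (K : nat) (x : 'rV[int]_m) : R :=
  dot s x + (if cell x \in box m K then correction (cell x) else 0) * plateau x.

(** Inside a cell the slope contributes at most [l1norm s] and the tapered correction at most
    [1 / D]; between cells the correction vanishes at both ends. *)
Lemma height_adj K x y : lattice_adj x y -> `|height K x - height K y| < 1.
Proof.
move=> xy; apply: le_lt_trans sD.
have dxy := dot_lipschitz R m s x y xy; rewrite /height.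
have [cxy|cxy] := eqVneq (cell x) (cell y); last first.
  have [-> ->] := cell_change m n D n_gt0 D_gt0 x y xy cxy R.
  by rewrite !mulr0 !addr0 (le_trans dxy) // lerDl invr_ge0.
rewrite cxy opprD addrACA -mulrBr (le_trans (ler_normD _ _)) // lerD //.
rewrite normrM -[leRHS]mul1r ler_pM //.
  by case: ifP => _; rewrite ?normr0 ?ler01 ?correction_le1.
exact: plateau_lipschitz.
Qed.

Definition surface (K : nat) (x : 'rV[int]_m) : int :=
  parity_round R T cT g (height K x) (cZ x).

Lemma surface_adj K x y : lattice_adj x y -> adj (g (surface K x)) (g (surface K y)).
Proof.
move=> xy; apply: g_adj; apply: parity_round_adj => //; first exact: height_adj.
exact: hcZ.
Qed.

(** The plateau is 1 on the core, so the height there is the slope height of the offset plus an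
    integer, and rounding commutes with that translation. *)
Lemma surface_core K x : cell x \in box m K -> offset x \in box m n ->
  surface K x = parity_round R T cT g (dot s (offset x)) (cZ (offset x)) +
    cell_shift (cell x).
Proof.
move=> cK on; rewrite /surface /height cK plateau_core // mulr1.
rewrite -{1 3}(origin_offset m n D x) dotD /correction.
rewrite (_ : _ + _ = dot s (offset x) + (cell_shift (cell x))%:~R); last by ring.
apply: parity_round_shift => //; rewrite parity_round_colour //.
rewrite (lattice_colour_add m cZ hcZ).
by case: (cZ (origin _)) (cZ (offset _)) (cZ 0) (cT _) => [] [] [] [].
Qed.

Section Window.
Variable N : nat.
Let K := (N %/ (n + D.*2))%N.

(** Some coordinate is 0 or [N - 1]. The latter, in a cell of [box m K], forces the [K] periods to
    fill [N] exactly, so the point lies on a face of its cell. *)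
Lemma plateau_boundary x : x \in boundary (box m N) -> cell x \in box m K -> plateau x = 0.
Proof.
move=> /boundary_box [i xi]; rewrite in_box => /forallP/(_ i); rewrite !mxE => ci.
apply: (plateau_edge m n D n_gt0 D_gt0 R x i).
have P0 : 0 < period n D by rewrite /period; lia.
case: xi => xi; first by left; rewrite xi mod0z.
right; have KN : K%:Z * period n D <= N%:Z.
  by have := leq_trunc_div N (n + D.*2); rewrite -/K /period; lia.
move: ci (divz_eq (x 0 i) (period n D)) (ltz_pmod (x 0 i) P0).
rewrite xi; move: (period n D) P0 KN (_ %/ _)%Z (_ %% _)%Z => P P0 KN a r ci e rP.
have : 0 <= (K%:Z - 1 - a) * P by apply: mulr_ge0; lia.
by lia.
Qed.

Lemma surface_boundary x :
  x \in boundary (box m N) -> g (surface K x) = slope_fun cZ cT g s x.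
Proof.
move=> xN; rewrite slope_funE /surface /height.
by case: ifP => [/(plateau_boundary _ xN) ->|_]; rewrite ?mulr0 ?mul0r addr0.
Qed.

Definition core (x : 'rV[int]_m) := (cell x \in box m K) && (offset x \in box m n).

Definition paste (H : 'rV[int]_m -> 'rV[int]_m -> T) (x : 'rV[int]_m) : T :=
  if core x then shift (cell_shift (cell x)) (H (cell x) (offset x))
  else g (surface K x).

Lemma paste_slope_hom (H : 'rV[int]_m -> 'rV[int]_m -> T) :
  (forall u, u \in box m K -> slope_hom R T adj m cZ cT g s n (H u)) ->
  slope_hom R T adj m cZ cT g s N (paste H).
Proof.
move=> HK.
(* A core point with a neighbour outside that core is on the boundary of the core, where the
   translated copy agrees with [surface]. *)
have out x y : lattice_adj x y -> ~~ (core y && (cell x == cell y)) ->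
    paste H x = g (surface K x).
  move=> xy; rewrite /paste; case: ifP => // /andP[cx ox] ncy.
  rewrite (HK _ cx).2 ?slope_funE ?shift_g ?surface_core //.
  apply/boundaryP; split=> //; exists (y - origin (cell x)); split.
    apply: contra ncy => yn; have e := subrK (origin (cell x)) y.
    rewrite addrC in e; rewrite /core.
    have ey : cell y = cell x by rewrite -e cell_origin.
    by rewrite ey cx eqxx andbT -{1}e offset_origin.
  by rewrite /lattice_adj /offset opprB addrA subrK.
split=> [x y xN yN xy|x xN]; last first.
  rewrite /paste; case: ifP => [/andP[cx ox]|_]; last exact: surface_boundary.
  (* A boundary point of the window in a core would have plateau both 1 and 0. *)
  have := plateau_boundary x xN cx; rewrite plateau_core // => /eqP.
  by rewrite oner_eq0.
have yx : lattice_adj y x by rewrite lattice_adjC.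
have [/and3P[cx cy /eqP cxy]|nc] := boolP [&& core x, core y & cell x == cell y].
  rewrite /paste cx cy cxy; apply: shift_adj; case/andP: cx cy => cx ox /andP[cy oy].
  rewrite -cxy; apply: (HK _ cx).1 => //.
  by rewrite /lattice_adj /offset cxy opprB addrA subrK.
have [cxy|cxy] := boolP (cell x == cell y); last first.
  rewrite (out x y) ?(out y x) //; first exact: surface_adj.
    by rewrite eq_sym (negPf cxy) andbF.
  by rewrite (negPf cxy) andbF.
rewrite cxy andbT negb_and in nc.
case/orP: nc => nc.
  rewrite (out y x) ?(negPf nc) // /paste (negPf nc); exact: surface_adj.
rewrite (out x y) ?(negPf nc) // /paste (negPf nc); exact: surface_adj.
Qed.

End Window.
End Cell.

Variable i0 : 'I_m.

(** The translations are only locally injective, so each copy is recovered from its boundary along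
    lines: equal values at [back y] and equal images at [y] give equal values at [y]. *)
Lemma paste_inj n N (H H' : 'rV[int]_m -> 'rV[int]_m -> T) : (0 < n)%N ->
  let K := (N %/ (n + D.*2))%N in
  (forall u, u \in box m K -> slope_hom R T adj m cZ cT g s n (H u)) ->
  (forall u, u \in box m K -> slope_hom R T adj m cZ cT g s n (H' u)) ->
  {in box m N, paste n N H =1 paste n N H'} ->
  forall u, u \in box m K -> {in box m n, H u =1 H' u}.
Proof.
move=> n0 K HK HK' HH u uK.
apply: (slope_hom_eq R T adj m cZ cT g s i0 n); [exact: HK|exact: HK'|].
have eqS y : y \in box m n -> shift (cell_shift n u) (H u y) = shift (cell_shift n u) (H' u y).
  move=> yn; have := HH _ (origin_in_box m n D n0 D_gt0 N u y uK yn).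
  by rewrite /paste /core cell_origin // offset_origin // uK yn.
move=> y yn byn e; apply: (shift_inj (cell_shift n u) (H u (back m i0 y))).
- by apply: (HK u uK).1 => //; exact: back_adj.
- by rewrite e; apply: (HK' u uK).1 => //; exact: back_adj.
- exact: eqS.
Qed.

Hypothesis hreg : is_regular adj d.

(** An extension is chosen independently in each of the [K ^ m] cells, and pasting is injective in
    these choices. *)
Lemma num_ext_supermul n N : (0 < n)%N ->
  (num_ext R T adj m cZ cT g s n ^ (N %/ (n + D.*2)) ^ m <=
   num_ext R T adj m cZ cT g s N)%N.
Proof.
move=> n0; set K := (N %/ _)%N.
pose E := fset_set (extensions adj (@slope_boundary R T m cZ cT g s n)).
pose H (a : {ffun box m K -> E}) (u : 'rV[int]_m) : 'rV[int]_m -> T :=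
  if insub u is Some z then extend T m g n (val (a z)) else fun=> g 0.
have HE a z : H a (val z) = extend T m g n (val (a z)) by rewrite /H valK.
have Hhom a u : u \in box m K -> slope_hom R T adj m cZ cT g s n (H a u).
  move=> uK; rewrite -[u]/(val [` uK]%fset) HE; apply/extensionsP => //.
  have := valP (a [` uK]%fset); rewrite in_fset_set => [/set_mem //|].
  exact: extensions_finite hreg _.
rewrite -[X in (_ ^ X)%N]card_box cardfE /num_ext -/E cardfE -card_ffun.
apply: (card_le_num_ext _ _ _ _ d _ _ _ _ i0 adj_irr hreg N _ (fun a => paste n N (H a))).
  by move=> a; apply: paste_slope_hom => // u; exact: Hhom.
move=> a b ab; apply/ffunP => z; apply: val_inj; apply/ffunP => y.
rewrite -!(extendE _ _ g) -!HE.
by apply: (paste_inj n N (H a) (H b) n0 (Hhom a) (Hhom b) ab); exact: valP.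
Qed.

End Pasting.

(** * Logarithms of counts and the Fekete argument *)

(** The convention that [ln] is 0 at 0 covers the case [p = 0]. *)
Lemma ln_natr_le (R : realType) (p q : nat) : (p <= q)%N -> ln p%:R <= ln q%:R :> R.
Proof.
case: p => [_|p pq]; last by rewrite ler_ln ?ler_nat // posrE ltr0n; lia.
rewrite (@ln0 _ 0%:R) ?lexx //; case: q => [|q]; first by rewrite ln0.
by rewrite ln_ge0 // ler1n.
Qed.

Lemma ln_natrX (R : realType) (p k : nat) : ln (p ^ k)%:R = k%:R * ln p%:R :> R.
Proof.
case: p => [|p]; last by rewrite natrX lnXn ?ltr0n // mulr_natl.
rewrite [ln 0%:R]ln0 ?lexx // mulr0; case: k => [|k]; first by rewrite expn0 ln1.
by rewrite exp0n // ln0.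
Qed.

Lemma cvg_one_plus_div (R : realType) (m : nat) (c : R) :
  (fun N : nat => (1 + c / N%:R) ^+ m) @ \oo --> (1 : R).
Proof.
suff : (fun N : nat => (1 + c / N%:R) ^+ m) @ \oo --> (1 + c * 0) ^+ m.
  by rewrite mulr0 addr0 expr1n.
apply: (@continuous_cvg _ _ _ _ _ _ (fun x : R => x ^+ m)); first exact: exprn_continuous.
apply: cvgD; first exact: cvg_cst.
apply: cvgMr => //.
apply/gtr0_cvgV0; last exact: cvgr_idn.
by near=> N; rewrite ltr0n; near: N; exact: nbhs_infty_gt.
Unshelve. all: by end_near.
Qed.

(* With [l] the supremum of [ln (a n) / (n + c) ^ m], the entropies are squeezed
   between [(1 - (n + c) / N) ^ m] times a value close to [l] and
   [(1 + c / N) ^ m * l]. *)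
Lemma supermultiplicative_cvg (R : realType) (m c L : nat) (a : nat -> nat) :
  (forall n, (a n <= L ^ (n ^ m))%N) ->
  (forall n N, (0 < n)%N -> (a n ^ (N %/ (n + c)) ^ m <= a N)%N) ->
  exists l : R, (fun n : nat => ln (a n)%:R / (n ^ m)%:R) @ \oo --> l.
Proof.
move=> aL a_super.
(* The denominator is the volume of a whole cell, corridor included. *)
pose b n : R := ln (a n)%:R / ((n + c) ^ m)%:R.
have a_ge0 n : 0 <= ln (a n)%:R :> R.
  by rewrite -[X in X <= _](@ln0 R 0%:R) ?lexx // ln_natr_le.
have L_ge0 : 0 <= ln L%:R :> R.
  by rewrite -[X in X <= _](@ln0 R 0%:R) ?lexx // ln_natr_le.
have b_ge0 n : 0 <= b n by rewrite divr_ge0.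
have bL n : (0 < n)%N -> b n <= ln L%:R.
  move=> n0; rewrite ler_pdivrMr ?ltr0n ?expn_gt0 ?addn_gt0 ?n0 //.
  apply: le_trans (ln_natr_le _ _ _ (aL n)) _.
  by rewrite ln_natrX mulrC ler_wpM2l // !natrX lerXn2r ?nnegrE ?ler0n // ler_nat leq_addr.
pose S := [set b n | n in [set n | (0 < n)%N]].
have supS : has_sup S.
  split; first by exists (b 1%N); exists 1%N.
  by exists (ln L%:R) => _ [n n0 <-]; exact: bL.
have b_sup n : (0 < n)%N -> b n <= sup S.
  by move=> n0; apply: sup_upper_bound => //; exists n.
have l_ge0 : 0 <= sup S := le_trans (b_ge0 1%N) (b_sup 1%N isT).
exists (sup S); apply/cvgrPdist_lt => e e0.
(* This [n] stays fixed while [N] tends to infinity. *)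
have [_ [n n0 <-] bn] := sup_adherent e0 supS.
have low : (fun N : nat => (1 + - (n + c)%:R / N%:R) ^+ m * b n) @ \oo --> b n.
  by rewrite -[X in _ --> X]mul1r; apply: cvgMl; exact: cvg_one_plus_div.
have upp : (fun N : nat => (1 + c%:R / N%:R) ^+ m * sup S) @ \oo --> sup S.
  by rewrite -[X in _ --> X]mul1r; apply: cvgMl; exact: cvg_one_plus_div.
have upp_lt : \forall N \near \oo, (1 + c%:R / N%:R) ^+ m * sup S < sup S + e.
  by apply: (cvgr_lt _ upp); rewrite ltrDl.
have low_gt : \forall N \near \oo,
    sup S - e < (1 + - (n + c)%:R / N%:R) ^+ m * b n.
  exact: (cvgr_gt _ low).
near=> N.
have N0 : (0 < N)%N by near: N; exact: nbhs_infty_gt.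
have nN : (n + c <= N)%N by near: N; exact: nbhs_infty_ge.
have N0' : N%:R != 0 :> R by rewrite pnatr_eq0 -lt0n.
have uN : ln (a N)%:R / (N ^ m)%:R <= (1 + c%:R / N%:R) ^+ m * sup S.
  rewrite (_ : _ / _ = (1 + c%:R / N%:R) ^+ m * b N).
    by rewrite ler_wpM2l ?b_sup // exprn_ge0 // addr_ge0 // divr_ge0.
  rewrite /b !natrX natrD (_ : 1 + c%:R / N%:R = (N%:R + c%:R) / N%:R); last by field.
  rewrite expr_div_n; field; rewrite ?expf_neq0 // -natrD pnatr_eq0; lia.
have lN : (1 + - (n + c)%:R / N%:R) ^+ m * b n <= ln (a N)%:R / (N ^ m)%:R.
  rewrite ler_pdivlMr ?ltr0n ?expn_gt0 ?N0 //.
  apply: le_trans (ln_natr_le _ _ _ (a_super n N n0)); rewrite ln_natrX /b.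
  set P := (n + c)%N in nN *; have P0 : (0 < P)%N by rewrite /P addn_gt0 n0.
  have P0' : P%:R != 0 :> R by rewrite pnatr_eq0 -lt0n.
  have -> : (1 + - P%:R / N%:R) ^+ m * (ln (a n)%:R / (P ^ m)%:R) * (N ^ m)%:R =
      ((N%:R - P%:R) / P%:R) ^+ m * ln (a n)%:R :> R.
    have -> : 1 + - P%:R / N%:R = (N%:R - P%:R) / N%:R :> R by field.
    by rewrite !natrX !expr_div_n; field; rewrite !expf_neq0.
  (* The integer quotient of [N] by [P] is at least [N / P - 1]. *)
  rewrite ler_wpM2r // natrX lerXn2r ?nnegrE ?divr_ge0 ?subr_ge0 ?ler_nat //.
  rewrite ler_pdivrMr ?ltr0n // lerBlDr -natrM -natrD ler_nat.
  by have := ltn_ceil N P0; rewrite mulSn addnC; exact: ltnW.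
have uN' : (1 + c%:R / N%:R) ^+ m * sup S < sup S + e by near: N.
have lN' : sup S - e < (1 + - (n + c)%:R / N%:R) ^+ m * b n by near: N.
by rewrite ltr_norml; apply/andP; split; lra.
Unshelve. all: by end_near.
Qed.

Theorem theorem2p11 (R : realType) (m d : nat) (hm : (2 <= m)%N) (hd : (2 <= d)%N)
    (T : choiceType) (adj : rel T) (r : T)
    (htree : is_tree adj) (hreg : is_regular adj d)
    (cZ : 'rV[int]_m -> bool) (hcZ : proper_2colouring (@lattice_adj m) cZ)
    (cT : T -> bool) (hcT : proper_2colouring adj cT)
    (g : int -> T) (hg : two_sided_geodesic adj g) (hg0 : g 0 = r)
    (s : 'rV[R]_m) (hs : l1norm s < 1) :
  exists l : R,
    (fun n : nat => Ent R adj (@slope_boundary R T m cZ cT g s n)) @ \oo --> l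
    /\ ent adj cZ cT g s = l.
Proof.
have [adjC adj_irr _ _] := htree.
have i0 : 'I_m by exists 0%N; lia.
have /boolp.choice[shift shiftP] := fun c => geodesic_shift T adj d g c htree hreg hg.
(* The corridor is wider than [1 / (1 - |s|_1)], so a correction of size at most 1 tapered across it
   fits in the slack of the slope. *)
pose D := (Num.bound (1 - l1norm s)^-1).+1.
have sD : l1norm s + D%:R^-1 < 1.
  have s1 : 0 < 1 - l1norm s by rewrite subr_gt0.
  rewrite -ltrBrDl -[ltRHS]invrK ltf_pV2 ?posrE ?invr_gt0 ?ltr0n //.
  apply: lt_le_trans (archi_boundP _) _; first by rewrite invr_ge0 ltW.
  by rewrite ler_nat.
have super n N : (0 < n)%N ->
    (num_ext R T adj m cZ cT g s n ^ (N %/ (n + D.*2)) ^ m <=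
     num_ext R T adj m cZ cT g s N)%N.
  apply: (num_ext_supermul R T adj m d D cZ cT g s shift) => //.
  - by move=> c k; case: (shiftP c).
  - by move=> c; case: (shiftP c).
  - by move=> c; case: (shiftP c).
have [l cvg_l] := supermultiplicative_cvg R m _ d.+1 _
  (num_ext_le R T adj m d cZ cT g s i0 adj_irr hreg) super.
have cvgE : (fun n : nat => Ent R adj (@slope_boundary R T m cZ cT g s n)) @ \oo --> - l.
  rewrite (_ : (fun n => _) = fun n => - (ln (num_ext R T adj m cZ cT g s n)%:R / (n ^ m)%:R)).
    exact: cvgN.
  by apply/funext => n; rewrite /Ent card_box mulNr mulrC.
by exists (- l); split=> //; rewrite /ent hs; exact: cvg_lim cvgE.
Qed.
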